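(* Let $b$ be a barrier function satisfying the assumptions listed in the context. For $\rho^*>0$ define $\psi^{\rm eq}_{\rho^*}$ by $$\psi^{\rm eq}_{\rho^*}(t)=\min_{z\in\mathbb{R}}\{\rho^* z+b(t-z)+b(-t-z)\},\qquad t\in\mathbb{R}.$$ Then for every $\rho^*>0$ one has that $$\psi^{\rm eq}_{\rho^*}(t)=\rho^* z_{\rho^*}(t)+b\bigl(t-z_{\rho^*}(t)\bigr)+b\bigl(-t-z_{\rho^*}(t)\bigr)$$ is convex, Lipschitz differentiable (that is, differentiable with globally Lipschitz continuous derivative), and $\rho^*$-Lipschitz continuous, with derivative $$(\psi^{\rm eq}_{\rho^*})'(t)=\rho^*-2b'\bigl(-t-z_{\rho^*}(t)\bigr)\in(-\rho^*,\rho^* ),$$ where, denoting $\rho=(b^* )'(\rho^* )<0$, $z_{\rho^*}(t)>|t|-\rho$ is the unique solution $z\in\mathbb{R}$ to the smooth monotone equation $$b'(t-z)+b'(-t-z)=\rho^*.$$ Moreover, for any $t\ne 0$ one has $\bigl|(\psi^{\rm eq}_{\rho^*})'(t)\bigr|\ge\rho^*-2b'(-|t|)$.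
   Context: Barrier assumptions: $b:\mathbb{R}\to\mathbb{R}\cup\{\pm\infty\}$ is proper, lower semicontinuous, and twice continuously differentiable on its domain $\operatorname{dom} b=(-\infty,0)$ (so $b=\infty$ on $[0,\infty)$), with $b'>0$ and $b''>0$ there. The convex conjugate is $b^*(\tau)=\sup_{t\in\mathbb{R}}\{\tau t-b(t)\}$, and $(b^* )'$ is its derivative. The equation for $z$ is understood over those $z$ with $t-z<0$ and $-t-z<0$.
   Formalization: The formal theorem additionally assumes that b*(τ) is finite for every τ>0, as needed for (b* )'(ρ* ) to exist for all ρ*>0; without it the claim fails, e.g. for b(t)=t−1/t on t<0 with ρ*=1. *)

(* Defs.v *)
From HB Require Import structures.
From mathcomp Require Import all_boot all_order all_algebra.
From mathcomp Require Import all_classical all_reals all_analysis.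
Import numFieldNormedType.Exports.

Set Implicit Arguments.
Unset Strict Implicit.
Unset Printing Implicit Defensive.

Import Order.TTheory GRing.Theory Num.Theory.

Local Open Scope ring_scope.
Local Open Scope classical_set_scope.

Definition edom (R : realType) (f : R -> \bar R) : set R :=
  [set x | (f x < +oo)%E].

Definition proper_fun (R : realType) (f : R -> \bar R) : Prop :=
  (edom f !=set0) /\ (forall x, (-oo < f x)%E).

(* [fine] sends -oo and +oo to 0, so [rpart f] represents [f] only where [f]
   is finite. *)
Definition rpart (R : realType) (f : R -> \bar R) : R -> R := fun x => fine (f x).

Definition conjugate (R : realType) (f : R -> \bar R) (tau : R) : \bar R :=
  ereal_sup (range (fun t : R => ((tau * t)%:E - f t)%E)).

(* Derivatives at [t < 0] are two-sided and see only the open domain, so the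
   value 0 of [rpart b] on [0, +oo[ does not interfere. *)
Record barrier (R : realType) (b : R -> \bar R) : Prop := Barrier {
  barrier_proper : proper_fun b;
  barrier_lsc : lower_semicontinuous b;
  barrier_dom : edom b = [set t | t < 0];
  barrier_C2 : forall t : R, t < 0 ->
    [/\ derivable (rpart b) t 1, derivable (derive1 (rpart b)) t 1 &
        {for t, continuous (derive1n 2 (rpart b))}];
  barrier_d1_gt0 : forall t : R, t < 0 -> 0 < derive1 (rpart b) t;
  barrier_d2_gt0 : forall t : R, t < 0 -> 0 < derive1n 2 (rpart b) t
}.

Definition obj_eq (R : realType) (b : R -> \bar R) (rhos t z : R) : \bar R :=
  ((rhos * z)%:E + b (t - z)%R + b (- t - z)%R)%E.

(* An infimum a priori; that it is attained has to be proved. *)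
Definition psi_eq (R : realType) (b : R -> \bar R) (rhos t : R) : \bar R :=
  ereal_inf (range (obj_eq b rhos t)).

Definition opt_lhs (R : realType) (b : R -> \bar R) (t z : R) : R :=
  derive1 (rpart b) (t - z) + derive1 (rpart b) (- t - z).

Definition opt_sol (R : realType) (b : R -> \bar R) (rhos t z : R) : Prop :=
  [/\ t - z < 0, - t - z < 0 & opt_lhs b t z = rhos].

(* Main.v *)
(* Write u = t - z(t) and v = - t - z(t).  Adding the tangents of b at u and v
   and using b'(u) + b'(v) = rhos to cancel the dependence on z shows that
   b'(u) - b'(v) is a subgradient of psi at t; z(t) exists because b' increases
   from 0 to +oo, by the finiteness of b^* and the lower semicontinuity of b at
   0.  A function with a subgradient that depends continuously on the point is
   convex and has the subgradient as its derivative, so everything about psi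
   reduces to estimates on b'(u) - b'(v), without the implicit function theorem.
   This subgradient is Lipschitz since the larger of u and v stays in the
   compact interval on which rhos / 2 <= b' <= rhos.  The same principle gives
   (b^* )' = (b')^-1. *)
Require Import Defs.
From mathcomp Require Import all_boot all_order all_algebra.
From mathcomp Require Import ring lra.
From mathcomp Require Import all_classical all_reals all_analysis.
Import Order.TTheory GRing.Theory Num.Theory.
Import numFieldNormedType.Exports.
Local Open Scope ring_scope.
Local Open Scope classical_set_scope.

(** * Derivative, convexity and Lipschitz bounds from subgradients *)

Section Subgradient.
Context {R : realType}.
Implicit Types f d : R -> R.
Local Open Scope convex_scope.

(** The two inequalities place [f s - f t - d t * (s - t)] between 0 and [(d s - d t) * (s - t)],
    which is o(s - t) by continuity of [d]. Only points near [t] enter, so the conjugate, controlled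
    only at positive arguments, is covered too. *)
Lemma is_derive_subgradient f d (t : R) :
  (\forall s \near t, f t + d t * (s - t) <= f s /\ f s + d s * (t - s) <= f t) ->
  {for t, continuous d} -> is_derive t 1 f (d t).
Proof.
move=> fd dt.
have key e : 0 < e ->
    \forall h \near (0 : R), `|f (t + h) - f t - d t * h| <= e * `|h|.
  move=> e0.
  have : \forall s \near t, `|f s - f t - d t * (s - t)| <= e * `|s - t|.
    near=> s.
    have [fts fst] : f t + d t * (s - t) <= f s /\ f s + d s * (t - s) <= f t.
      by near: s.
    have dse : `|d t - d s| <= e.
      by near: s; move/cvgrPdist_le : dt; exact.
    rewrite ger0_norm; last by rewrite -addrA -opprD subr_ge0.
    apply: (@le_trans _ _ ((d s - d t) * (s - t))); first by nra.
    apply: (le_trans (ler_norm _)); rewrite normrM distrC.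
    by rewrite ler_wpM2r.
  move/(nbhs0P _ t) => h; near=> x.
  have : `|f (t + x) - f t - d t * (t + x - t)| <= e * `|t + x - t|.
    by near: x.
  by have -> : t + x - t = x by ring.
have cf : h^-1 *: ((f \o shift t) (h *: 1) - f t) @[h --> 0^'] --> d t.
  apply/cvgrPdist_le => e e0; near=> h.
  have h0 : h != 0 by near: h; exact: nbhs_dnbhs_neq.
  have : `|f (t + h) - f t - d t * h| <= e * `|h|.
    by near: h; apply: nbhs_dnbhs; exact: key.
  rewrite /= [h *: 1]mulr1 [h + t]addrC -ler_pdivrMr ?normr_gt0//.
  rewrite -normfV -normrM -normrN; congr (`|_| <= _).
  by rewrite [_ *: _]mulrC; field.
by split; [exact: cvgP cf | exact: cvg_lim cf].
Unshelve. all: by end_near. Qed.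

(** The tangent at the convex combination [m] is averaged over [x] and [y]; its linear terms
    cancel. *)
Lemma subgradient_convex f d :
  (forall s t : R, f t + d t * (s - t) <= f s) -> convex_function setT f.
Proof.
move=> fd.
have conv (p x y : R) : 0 <= p -> p <= 1 ->
    f (p * x + (1 - p) * y) <= p * f x + (1 - p) * f y.
  set m := p * x + _ => p0 p1.
  have hx : p * (f m + d m * (x - m)) <= p * f x by rewrite ler_wpM2l.
  have hy : (1 - p) * (f m + d m * (y - m)) <= (1 - p) * f y.
    by rewrite ler_wpM2l// subr_ge0.
  suff : p * (f m + d m * (x - m)) + (1 - p) * (f m + d m * (y - m)) = f m.
    by move=> <-; exact: lerD.
  by rewrite /m; ring.
by move=> t x y _ _; exact: conv.
Qed.

(** The slope at the point with the larger value bounds the difference, whence the reduction to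
    [f y <= f x]. *)
Lemma subgradient_lipschitz f d (k : R) :
  (forall s t : R, f t + d t * (s - t) <= f s) -> (forall t, `|d t| <= k) ->
  k.-lipschitz f.
Proof.
move=> fd dk [x y] _ /=; rewrite /self_sub/=.
wlog fxy : x y / f y <= f x.
  move=> H; case: (leP (f y) (f x)) => [/H//|/ltW/H].
  by rewrite distrC [`|x - y|]distrC.
rewrite ger0_norm ?subr_ge0//.
apply: (@le_trans _ _ (d x * (x - y))); first by have := fd y x; nra.
by apply: (le_trans (ler_norm _)); rewrite normrM ler_wpM2r.
Qed.

End Subgradient.

(** * Monotonicity of [g] and tangents of the barrier *)

Section Barrier.
Set Implicit Arguments.
Unset Strict Implicit.
Context {R : realType} {b : R -> \bar R} (hb : barrier b).
Implicit Types c u x y t z w : R.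
Local Notation B := (rpart b).
Local Notation g := (derive1 B).
Local Notation g' := (derive1n 2 B).

Lemma barrier_fin x : x < 0 -> b x = (B x)%:E.
Proof.
move=> x0; rewrite /rpart fineK// fin_numE.
have [_ /(_ x)] := barrier_proper hb; rewrite ltNye => -> /=.
have : edom b x by rewrite barrier_dom.
by rewrite /edom/= lt_neqAle => /andP[].
Qed.

Lemma barrier_pinfty x : 0 <= x -> b x = +oo%E.
Proof.
move=> x0; apply/eqP; apply: contraT => bx.
have : edom b x by rewrite /edom/= ltey.
by rewrite barrier_dom//= ltNge x0.
Qed.

Lemma barrier_is_derive x : x < 0 -> is_derive x 1 B (g x).
Proof.
by move=> /(barrier_C2 hb)[dB _ _]; rewrite derive1E; exact: derivableP.
Qed.

Lemma barrier_is_derive2 x : x < 0 -> is_derive x 1 g (g' x).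
Proof.
move=> /(barrier_C2 hb)[_ dB _].
by rewrite derive1nS derive1n1 derive1E; exact: derivableP.
Qed.

Lemma negative_MVT (f df : R -> R) : (forall x, x < 0 -> is_derive x 1 f (df x)) ->
  forall x y, x < y -> y < 0 ->
  exists2 c, x < c < y & f y - f x = df c * (y - x).
Proof.
move=> fdf x y xy y0; have [||c cxy ->] := @MVT R f df x y xy.
- by move=> z; rewrite in_itv/= => /andP[_ zy]; apply: fdf; exact: lt_trans y0.
- apply: derivable_within_continuous => z; rewrite in_itv/= => /andP[_ zy].
  by have [] := fdf z (le_lt_trans zy y0).
by exists c => //; rewrite in_itv/= in cxy.
Qed.

Lemma barrier_d1_incr x y : x < y -> y < 0 -> g x < g y.
Proof.
move=> xy y0.
have [c /andP[_ cy] gxy] := negative_MVT barrier_is_derive2 xy y0.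
by rewrite -subr_gt0 gxy mulr_gt0 ?subr_gt0// barrier_d2_gt0// (lt_trans cy).
Qed.

Lemma barrier_d1_lt x y : x < 0 -> y < 0 -> (g x < g y) = (x < y).
Proof.
move=> x0 y0; apply/idP/idP => [|xy]; last exact: barrier_d1_incr.
apply: contraTT; rewrite -!leNgt le_eqVlt => /orP[/eqP->//|yx].
exact/ltW/barrier_d1_incr.
Qed.

Lemma barrier_d1_le x y : x < 0 -> y < 0 -> (g x <= g y) = (x <= y).
Proof. by move=> x0 y0; rewrite !leNgt barrier_d1_lt. Qed.

Lemma barrier_tangent_real u x : u < 0 -> x < 0 -> B u + g u * (x - u) <= B x.
Proof.
move=> u0 x0; have [ux|xu|<-] := ltgtP u x; last by rewrite subrr mulr0 addr0.
- have [c /andP[uc cx] Bux] := negative_MVT barrier_is_derive ux x0.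
  have : g u < g c by rewrite barrier_d1_lt// (lt_trans cx).
  nra.
- have [c /andP[xc cu] Bux] := negative_MVT barrier_is_derive xu u0.
  have : g c < g u by rewrite barrier_d1_lt// (lt_trans cu).
  nra.
Qed.

(** Since [b] is [+oo] off its domain, tangents minorize it on the whole line, so infima and suprema
    over all arguments can be bounded without sign conditions. *)
Lemma barrier_tangent u x : u < 0 -> ((B u + g u * (x - u))%:E <= b x)%E.
Proof.
move=> u0; have [x0|x0] := leP 0 x; first by rewrite barrier_pinfty// leey.
by rewrite barrier_fin// lee_fin; exact: barrier_tangent_real.
Qed.

(* [b] is lower semicontinuous at 0 with [b 0 = +oo], so it cannot stay below
   an affine bound near 0. *)
Lemma barrier_d1_unbounded c : exists2 x, x < 0 & c < g x.
Proof.
apply: contrapT => gc.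
have {}gc x : x < 0 -> g x <= c.
  by move=> x0; rewrite leNgt; apply/negP => cx; apply: gc; exists x.
have c0 : 0 < c by rewrite (lt_le_trans (barrier_d1_gt0 hb (ltrN10 _)))// gc// ltrN10.
(* A slope bounded by [c] keeps [B] bounded on ]-1, 0[. *)
have Bc x : -1 < x -> x < 0 -> B x <= B (-1) + c.
  move=> x1 x0.
  have [y /andP[_ yx] Bx] := negative_MVT barrier_is_derive x1 x0.
  have := gc y (lt_trans yx x0).
  have := barrier_d1_gt0 hb (lt_trans yx x0).
  nra.
have [|V /nbhs_ballP[e /= e0 eV] Vb] := barrier_lsc hb (x := 0) (a := B (-1) + c).
  by rewrite barrier_pinfty// ltey.
(* [- m] lies both in the ball given by semicontinuity and in ]-1, 0[, where the two bounds
   clash. *)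
pose m := Num.min e 1 / 2.
have m0 : 0 < m by rewrite /m divr_gt0// lt_min e0 ltr01.
have [me m1] : m < e /\ m < 1.
  by apply/andP; rewrite -lt_min /m ltr_pdivrMr// ltr_pMr ?lt_min ?e0 ?ltr01 ?ltr1n.
have bm : ball (0 : R) e (- m) by rewrite /ball/= sub0r opprK gtr0_norm.
have := Vb _ (eV _ bm); rewrite barrier_fin ?oppr_lt0// lte_fin ltNge Bc//.
- by rewrite ltrN2.
- by rewrite oppr_lt0.
Qed.

(** * Surjectivity of [g] onto the positive reals and derivative of the conjugate *)

Context (hconj : forall tau : R, 0 < tau -> (conjugate b tau < +oo)%E).

(** If [g] stayed above [c], then [c / 2 * x - B x] would tend to [+oo] as [x] tends to [-oo], and
    the conjugate would be infinite at [c / 2]. *)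
Lemma barrier_d1_small c : 0 < c -> exists2 x, x < 0 & g x < c.
Proof.
move=> c0; apply: contrapT => gc.
have {}gc x : x < 0 -> c <= g x.
  by move=> x0; rewrite leNgt; apply/negP => cx; apply: gc; exists x.
have c2 : 0 < c / 2 by rewrite divr_gt0.
have := hconj c2; rewrite ltNge => /negP; apply.
rewrite leye_eq; apply/eqP/eq_infty => t.
(* The mean value theorem on [x < -1] gives the lower bound [- (c / 2 * x) - B (-1) - c], which this
   [x] makes at least [t]. *)
pose M := `|t + B (-1) + c| / c; pose x := - 2 - 2 * M.
have x1 : x < -1.
  have M0 : 0 <= M by rewrite divr_ge0// ltW.
  by rewrite /x; lra.
have x0 : x < 0 by rewrite (lt_trans x1)// ltrN10.
apply: (@le_trans _ _ ((c / 2 * x)%:E - b x)%E); last first.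
  by apply: ereal_sup_ubound; exists x.
rewrite barrier_fin// lee_fin.
have [y /andP[_ yx] Bx] := negative_MVT barrier_is_derive x1 (ltrN10 _).
have gy := gc y (lt_trans yx (ltrN10 _)).
have cx : c * x = - 2 * c - 2 * `|t + B (-1) + c|.
  by rewrite /x /M; field; rewrite gt_eqF.
have := ler_norm (t + B (-1) + c).
nra.
Qed.

Lemma barrier_d1_surj c : 0 < c -> exists2 x, x < 0 & g x = c.
Proof.
move=> c0; have [x x0 gx] := barrier_d1_small c0.
have [y y0 gy] := barrier_d1_unbounded c.
have xy : x < y by rewrite -barrier_d1_lt// (lt_trans gx).
have [||z] := @IVT R g x y c (ltW xy).
- apply: derivable_within_continuous => z; rewrite in_itv/= => /andP[_ zy].
  by have [] := barrier_is_derive2 (le_lt_trans zy y0).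
- by rewrite ge_min le_max (ltW gx) (ltW gy) orbT.
- by rewrite in_itv/= => /andP[_ zy] gz; exists z => //; exact: le_lt_trans y0.
Qed.

(** The tangent at [x] shows that the supremum is attained at [x]. *)
Lemma conjugate_barrier_d1 x : x < 0 -> conjugate b (g x) = (g x * x - B x)%:E.
Proof.
move=> x0; apply/eqP; rewrite eq_le; apply/andP; split.
  apply: ge_ereal_sup => _ [t _ <-].
  apply: (@le_trans _ _ ((g x * t)%:E - (B x + g x * (t - x))%:E)%E).
    by apply: leeB => //; exact: barrier_tangent.
  by rewrite lee_fin le_eqVlt; apply/orP; left; apply/eqP; ring.
by rewrite EFinB -barrier_fin//; apply: ereal_sup_ubound; exists x.
Qed.

Lemma conjugate_is_derive x : x < 0 -> is_derive (g x) 1 (rpart (conjugate b)) x.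
Proof.
move=> x0.
(* [inv] is constrained only at positive arguments, which fill a neighbourhood of [g x]. *)
have /choice[inv invP] : forall s : R, exists y, 0 < s -> y < 0 /\ g y = s.
  move=> s; have [s0|_] := ltP 0 s; last by exists 0.
  by have [y] := barrier_d1_surj s0; exists y.
have invx : inv (g x) = x.
  have [i0 gi] := invP _ (barrier_d1_gt0 hb x0).
  by apply/le_anti; rewrite -(barrier_d1_le i0 x0) -(barrier_d1_le x0 i0) gi lexx.
have cinv : {for g x, continuous inv}.
  apply/cvgrPdist_le => e e0; rewrite invx.
  (* The cap [x / 2] keeps [y] negative, where [g] can be used to compare arguments. *)
  pose y := Num.min (x + e) (x / 2).
  have y0 : y < 0 by rewrite /y gt_min; apply/orP; right; lra.
  have xy : x < y by rewrite /y lt_min; apply/andP; split; lra.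
  have ye : y <= x + e by rewrite /y ge_min lexx.
  near=> s.
  have s0 : 0 < s by near: s; apply: lt_nbhsr; exact: barrier_d1_gt0.
  have [i0 gi] := invP _ s0.
  have xe0 : x - e < 0 by lra.
  have xei : x - e < inv s.
    rewrite -barrier_d1_lt// gi; near: s; apply: lt_nbhsr.
    by rewrite barrier_d1_lt//; lra.
  have iy : inv s < y.
    by rewrite -barrier_d1_lt// gi; near: s; apply: lt_nbhsl; rewrite barrier_d1_lt.
  by rewrite ler_norml; apply/andP; split; lra.
rewrite -{2}invx; apply: is_derive_subgradient => //; near=> s.
have s0 : 0 < s by near: s; apply: lt_nbhsr; exact: barrier_d1_gt0.
have [i0 gi] := invP _ s0.
have fx : rpart (conjugate b) (g x) = g x * x - B x.
  by rewrite {1}/rpart conjugate_barrier_d1.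
have fs : rpart (conjugate b) s = s * inv s - B (inv s).
  by rewrite -{1 2}gi {1}/rpart conjugate_barrier_d1.
rewrite fx fs invx.
(* The tangents of [B] at [inv s] and at [x] turn into the two subgradient inequalities for the
   conjugate. *)
have := barrier_tangent_real x0 i0; have := barrier_tangent_real i0 x0.
by rewrite gi => ? ?; split; lra.
Unshelve. all: by end_near. Qed.

(** * The equation for [z]: smoothness, uniqueness, existence *)

Lemma opt_lhs_is_derive t z : `|t| < z ->
  is_derive z 1 (opt_lhs b t) (- (g' (t - z) + g' (- t - z))).
Proof.
rewrite ltr_norml => /andP[zt tz].
have dg s : s - z < 0 -> is_derive z 1 (fun w => g (s - w)) (- g' (s - z)).
  move=> sz.
  have dsz : is_derive z 1 (fun w : R => s - w) (- 1).
    by have := is_deriveB (is_derive_cst s z 1) (is_derive_id z 1); rewrite sub0r.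
  have := @is_derive1_comp _ g (fun w => s - w) _ _ _ (barrier_is_derive2 sz) dsz.
  by rewrite mulrN1.
rewrite opprD; apply: is_deriveD; apply: dg; lra.
Qed.

Lemma opt_lhs_derive1_continuous t z : `|t| < z ->
  {for z, continuous (derive1 (opt_lhs b t))}.
Proof.
move=> tz.
have d1 w : `|t| < w -> derive1 (opt_lhs b t) w = - (g' (t - w) + g' (- t - w)).
  by move=> tw; have /@derive_val := opt_lhs_is_derive tw; rewrite derive1E.
have cg s : s - z < 0 -> g' (s - w) @[w --> z] --> g' (s - z).
  move=> sz; have [_ _ cg] := barrier_C2 hb sz.
  apply: (continuous_comp (f := fun w => s - w)) => //.
  by apply: cvgB; [exact: cvg_cst | exact: cvg_id].
have : - (g' (t - w) + g' (- t - w)) @[w --> z] --> derive1 (opt_lhs b t) z.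
  move: (tz); rewrite ltr_norml => /andP[zt zt'].
  by rewrite d1//; apply: cvgN; apply: cvgD; apply: cg; lra.
apply: cvg_trans; apply: near_eq_cvg; near=> w.
by rewrite /= d1//; near: w; exact: lt_nbhsr.
Unshelve. all: by end_near. Qed.

Lemma opt_lhs_decr t z w : `|t| < z -> z < w -> opt_lhs b t w < opt_lhs b t z.
Proof.
rewrite ltr_norml => /andP[zt tz] zw; rewrite /opt_lhs.
by apply: ltrD; apply: barrier_d1_incr; lra.
Qed.

Section Solution.
Context (c : R) (c0 : 0 < c).

Lemma opt_sol_norm t z : opt_sol b c t z -> `|t| < z.
Proof. by move=> [? ? _]; rewrite ltr_norml; apply/andP; split; lra. Qed.

Lemma opt_sol_inj t z w : opt_sol b c t z -> opt_sol b c t w -> z = w.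
Proof.
move=> hz hw; have [_ _ ez] := hz; have [_ _ ew] := hw.
have [zw|wz|//] := ltgtP z w.
- by have := opt_lhs_decr (opt_sol_norm hz) zw; rewrite ez ew ltxx.
- by have := opt_lhs_decr (opt_sol_norm hw) wz; rewrite ez ew ltxx.
Qed.

Lemma opt_solN t z : opt_sol b c t z -> opt_sol b c (- t) z.
Proof. by move=> [? ? e]; split; rewrite ?opprK// /opt_lhs opprK addrC. Qed.

(** For [0 <= t], positivity of the other summand gives [g (t - z) < c = g r], hence [t - z < r];
    negative [t] follows by symmetry. *)
Lemma opt_sol_gt t z r : r < 0 -> g r = c -> opt_sol b c t z -> `|t| - r < z.
Proof.
move=> r0 gr.
wlog t0 : t / 0 <= t.
  move=> H; case: (leP 0 t) => [/H//|/ltW t0 /opt_solN].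
  by rewrite -normrN; apply: H; rewrite oppr_ge0.
move=> [tz tz' e]; rewrite ger0_norm// ltrBlDr -ltrBlDl -barrier_d1_lt// gr -e.
by rewrite ltrDl; exact: barrier_d1_gt0.
Qed.

(** Intermediate values, with [g r = c] and [g q = c / 2]: at [|t| - r] the larger argument is [r],
    so the sum exceeds [c]; at [|t| - q] both arguments are at most [q], so the sum is at most
    [c]. *)
Lemma opt_sol_exists t : exists z, opt_sol b c t z.
Proof.
have c2 : 0 < c / 2 by rewrite divr_gt0.
have [r r0 gr] := barrier_d1_surj c0.
have [q q0 gq] := barrier_d1_surj c2.
have qr : q < r by rewrite -barrier_d1_lt// gq gr ltr_pdivrMr// ltr_pMr// ltr1n.
have [|||z] := @IVT R (opt_lhs b t) (`|t| - r) (`|t| - q) c.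
- by rewrite lerD2l lerN2 ltW.
- apply: derivable_within_continuous => z; rewrite in_itv/= => /andP[tz _].
  by have [] // := @opt_lhs_is_derive t z; lra.
- apply/andP; split.
    rewrite ge_min; apply/orP; right; rewrite /opt_lhs.
    have := ler_norm t; have := ler_norm (- t); rewrite normrN => tl tr.
    have : g (t - (`|t| - q)) <= g q by rewrite barrier_d1_le//; lra.
    have : g (- t - (`|t| - q)) <= g q by rewrite barrier_d1_le//; lra.
    by rewrite gq; lra.
  rewrite le_max; apply/orP; left; rewrite /opt_lhs.
  have [t0|t0] := leP 0 t.
    rewrite ger0_norm//; have -> : t - (t - r) = r by ring.
    by rewrite gr lerDl ltW// barrier_d1_gt0//; lra.
  rewrite ltr0_norm//; have -> : - t - (- t - r) = r by ring.
  by rewrite gr lerDr ltW// barrier_d1_gt0//; lra.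
rewrite in_itv/= => /andP[tz _] e; exists z.
by have := ler_norm t; have := ler_norm (- t); rewrite normrN => tl tr; split=> //; lra.
Qed.

(** The future derivative of the minimum value, written as a difference so that it is visibly odd in
    [t]. *)
Definition opt_slope t z : R := g (t - z) - g (- t - z).

Lemma opt_slopeE t z : opt_sol b c t z -> opt_slope t z = c - g (- t - z) *+ 2.
Proof. by move=> [_ _ <-]; rewrite /opt_slope /opt_lhs mulr2n; ring. Qed.

(** The slope is the difference, and [c] the sum, of the same two positive numbers. *)
Lemma opt_slope_bound t z : opt_sol b c t z -> - c < opt_slope t z < c.
Proof.
move=> [/(barrier_d1_gt0 hb) gu /(barrier_d1_gt0 hb) gv <-].
by rewrite /opt_slope /opt_lhs; apply/andP; split; lra.
Qed.

(** * The minimum value, its subgradient and estimates on it *)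

Lemma obj_eq_sol t z : opt_sol b c t z ->
  obj_eq b c t z = (c * z + B (t - z) + B (- t - z))%:E.
Proof. by move=> [u0 v0 _]; rewrite /obj_eq !barrier_fin. Qed.

(* Adding the tangents of [b] at [t - z] and [- t - z] cancels the dependence
   on [w], by the equation that [z] solves. *)
Lemma obj_eq_ge t z s w : opt_sol b c t z ->
  ((c * z + B (t - z) + B (- t - z) + opt_slope t z * (s - t))%:E
    <= obj_eq b c s w)%E.
Proof.
move=> [u0 v0 e]; rewrite /obj_eq.
apply: le_trans (leeD (leeD (lexx _) (barrier_tangent (s - w) u0))
  (barrier_tangent (- s - w) v0)).
rewrite -!EFinD lee_fin le_eqVlt; apply/orP; left; apply/eqP.
by rewrite /opt_slope -e /opt_lhs; ring.
Qed.

(** The bound [obj_eq_ge] at [s = t] says that [z] is a minimizer. *)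
Lemma psi_eq_sol t z : opt_sol b c t z -> psi_eq b c t = obj_eq b c t z.
Proof.
move=> tz; apply/eqP; rewrite eq_le; apply/andP; split.
  by apply: ereal_inf_lbound; exists z.
apply: le_ereal_inf_tmp => _ [w _ <-].
apply: le_trans (obj_eq_ge t w tz).
by rewrite obj_eq_sol// subrr mulr0 addr0.
Qed.

Lemma psi_eq_subgradient t z s y : opt_sol b c t z -> opt_sol b c s y ->
  rpart (psi_eq b c) t + opt_slope t z * (s - t) <= rpart (psi_eq b c) s.
Proof.
move=> tz sy; have := obj_eq_ge s y tz.
by rewrite /rpart (psi_eq_sol tz) (psi_eq_sol sy) (obj_eq_sol tz) (obj_eq_sol sy) lee_fin.
Qed.

(* For [0 <= t] the larger argument [t - z] satisfies [c / 2 <= b' (t - z) < c],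
   hence stays in a compact subset of the domain, on which [b''] is bounded. *)
Lemma opt_slope_lipschitz_ge0 : exists2 K : R, 0 < K &
  forall t z s y, 0 <= t -> t <= s -> opt_sol b c t z -> opt_sol b c s y ->
  0 <= opt_slope s y - opt_slope t z <= K * (s - t).
Proof.
have c2 : 0 < c / 2 by rewrite divr_gt0.
have [r r0 gr] := barrier_d1_surj c0.
have [q q0 gq] := barrier_d1_surj c2.
have qr : q < r by rewrite -barrier_d1_lt// gq gr ltr_pdivrMr// ltr_pMr// ltr1n.
have [|k kqr kM] := @EVT_max R g' q r (ltW qr).
  apply: continuous_in_subspaceT => x; rewrite inE/= in_itv/= => /andP[_ xr].
  by have [] := barrier_C2 hb (le_lt_trans xr r0).
have M0 : 0 < g' k.
  apply: barrier_d2_gt0 => //.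
  by move: kqr; rewrite in_itv/= => /andP[_ /le_lt_trans]; apply.
(* The slope is [2 * g (t - z) - c], and [t - z] grows by at most [2 * (s - t)]; hence the factor
   4. *)
exists (4 * g' k); first by rewrite mulr_gt0.
move=> t z s y t0 ts [u1 v1 e1] [u2 v2 e2]; rewrite /opt_lhs in e1 e2.
have gv1 : g (- t - z) <= g (t - z) by rewrite barrier_d1_le//; lra.
have gv2 : 0 < g (- s - y) by exact: barrier_d1_gt0.
(* If the larger argument decreased, the equation would make the smaller one increase, but their gap
   [2 * t] cannot shrink. *)
have uu : t - z <= s - y.
  rewrite leNgt; apply/negP => su; have := su; rewrite -barrier_d1_lt// => gsu.
  have : g (- t - z) < g (- s - y) by lra.
  by rewrite barrier_d1_lt// => ?; lra.
have guu : g (t - z) <= g (s - y) by rewrite barrier_d1_le.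
have vv : - s - y <= - t - z by rewrite -barrier_d1_le//; lra.
have qu : q <= t - z by rewrite -barrier_d1_le//; lra.
have ur : s - y < r by rewrite -barrier_d1_lt//; lra.
have gM : g (s - y) - g (t - z) <= g' k * (s - y - (t - z)).
  have [uu'|uu'] := ltP (t - z) (s - y); last first.
    have -> : s - y = t - z by apply/le_anti/andP.
    by rewrite !subrr mulr0.
  have [x /andP[ux xu] ->] := negative_MVT barrier_is_derive2 uu' u2.
  apply: ler_wpM2r; first by rewrite subr_ge0.
  apply: kM; rewrite in_itv/=; apply/andP; split.
    exact: le_trans qu (ltW ux).
  exact/ltW/(lt_trans xu).
have : g' k * (s - y - (t - z)) <= g' k * (2 * (s - t)).
  by rewrite ler_wpM2l ?(ltW M0)//; lra.
by rewrite /opt_slope; move=> ?; apply/andP; split; lra.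
Qed.

Lemma opt_slopeN t z : opt_slope (- t) z = - opt_slope t z.
Proof. by rewrite /opt_slope opprK opprB. Qed.

(** Oddness transfers the estimate to nonpositive arguments. For opposite signs the two estimates
    are joined at 0, where the slope vanishes, with the same [K]. *)
Lemma opt_slope_lipschitz : exists2 K : R, 0 < K &
  forall t z s y, opt_sol b c t z -> opt_sol b c s y ->
  `|opt_slope s y - opt_slope t z| <= K * `|s - t|.
Proof.
have [K K0 HK] := opt_slope_lipschitz_ge0; exists K => // t z s y.
wlog ts : t z s y / t <= s.
  move=> H tz sy; have [ts|/ltW st] := leP t s; first exact: H.
  by rewrite distrC [`|s - t|]distrC; exact: H.
move=> tz sy; rewrite [`|s - t|]ger0_norm ?subr_ge0//.
have [t0|/ltW t0] := leP 0 t.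
  by have /andP[? ?] := HK _ _ _ _ t0 ts tz sy; rewrite ger0_norm.
have Nt0 : 0 <= - t by rewrite oppr_ge0.
have [s0|/ltW s0] := leP s 0.
  have Ns0 : 0 <= - s by rewrite oppr_ge0.
  have Nst : - s <= - t by rewrite lerN2.
  have := HK _ _ _ _ Ns0 Nst (opt_solN sy) (opt_solN tz).
  by rewrite !opt_slopeN => /andP[? ?]; rewrite ger0_norm; lra.
have [x x0] := opt_sol_exists 0.
have := HK _ _ _ _ (lexx 0) s0 x0 sy.
have := HK _ _ _ _ (lexx 0) Nt0 x0 (opt_solN tz).
have -> : opt_slope 0 x = 0 by rewrite /opt_slope oppr0 subrr.
rewrite opt_slopeN => /andP[? ?] /andP[? ?]; rewrite ger0_norm; lra.
Qed.

(** Up to sign the slope is [c] minus twice [g] at the smaller argument [- |t| - z], which lies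
    below [- |t|] because [z] is positive. *)
Lemma opt_slope_norm_ge t z : opt_sol b c t z -> t != 0 ->
  c - g (- `|t|) *+ 2 <= `|opt_slope t z|.
Proof.
move=> tz t0; have tz' := opt_sol_norm tz.
have Nt0 : - `|t| < 0 by rewrite oppr_lt0 normr_gt0.
move: tz => [u0 v0 <-]; rewrite /opt_slope /opt_lhs mulr2n.
have [t1|t1] := leP 0 t.
  rewrite ger0_norm// in tz' Nt0 *; apply: le_trans (ler_norm _).
  have : g (- t - z) <= g (- t) by rewrite barrier_d1_le//; lra.
  lra.
rewrite ltr0_norm// opprK in tz' Nt0 *; rewrite -normrN; apply: le_trans (ler_norm _).
have : g (t - z) <= g t by rewrite barrier_d1_le//; lra.
lra.
Qed.

End Solution.
End Barrier.

Theorem theorem3p6 (R : realType) (b : R -> \bar R) (hb : barrier b)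
    (* presupposed by (b^* )' at every rho^* > 0; fails for b t = t - 1 / t *)
    (hconj : forall tau : R, 0 < tau -> (conjugate b tau < +oo)%E)
    (rhos : R) (rhos_gt0 : 0 < rhos) :
  let rho := derive1 (rpart (conjugate b)) rhos in
  let psi := rpart (psi_eq b rhos) in
  [/\ derivable (rpart (conjugate b)) rhos 1, rho < 0,
      (* the equation is smooth and monotone on the z > |t| *)
      forall t : R,
        [/\ forall z : R, `|t| < z -> derivable (opt_lhs b t) z 1,
            forall z : R, `|t| < z -> {for z, continuous (derive1 (opt_lhs b t))} &
            forall z w : R, `|t| < z -> z < w -> opt_lhs b t w < opt_lhs b t z] &
      exists z : R -> R,
        [/\ forall t : R, unique (opt_sol b rhos t) (z t) /\ `|t| - rho < z t,
            forall t : R,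
                psi_eq b rhos t \is a fin_num /\
                psi_eq b rhos t = obj_eq b rhos t (z t),
            [/\ convex_function setT psi, rhos.-lipschitz psi,
                forall t : R, derivable psi t 1 & lipschitz (derive1 psi)],
            forall t : R,
              derive1 psi t = rhos - derive1 (rpart b) (- t - z t) *+ 2 /\
              - rhos < derive1 psi t < rhos &
            forall t : R, t != 0 ->
              rhos - derive1 (rpart b) (- `|t|) *+ 2 <= `|derive1 psi t|]].
Proof.
move=> rho psi.
(* The preimage of [rhos] under [g] is identified with [rho], which is thereby negative. *)
have [r r0 gr] := barrier_d1_surj hb hconj rhos_gt0.
have dr : is_derive rhos 1 (rpart (conjugate b)) r.
  by rewrite -gr; exact: conjugate_is_derive.
have rhor : rho = r by rewrite /rho derive1E; exact: derive_val.
split; [exact: ex_derive | by rewrite rhor | | ].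
  move=> t; split=> z tz.
  - by have [] := opt_lhs_is_derive hb tz.
  - exact: opt_lhs_derive1_continuous.
  - by move=> w; exact: opt_lhs_decr.
have /choice[z zP] : forall t, exists w, opt_sol b rhos t w.
  by move=> t; exact: opt_sol_exists.
pose d t := opt_slope (b := b) t (z t).
have psid (s t : R) : psi t + d t * (s - t) <= psi s by exact: psi_eq_subgradient.
have [K K0 dK] := opt_slope_lipschitz hb hconj rhos_gt0.
have dcont (t : R) : {for t, continuous d}.
  have /cvgrPdist_le tt := @cvg_id R (nbhs t).
  apply/cvgrPdist_le => e e0; near=> s.
  apply: (le_trans (dK _ _ _ _ (zP s) (zP t))).
  rewrite -ler_pdivlMl//.
  by near: s; apply: tt; rewrite mulr_gt0// invr_gt0.
have dpsi (t : R) : is_derive t 1 psi (d t).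
  apply: is_derive_subgradient => //; near=> s; split; exact: psid.
have psi'E : derive1 psi = d.
  by apply/funext => t; rewrite derive1E; exact: derive_val.
have dbound t : - rhos < d t < rhos by exact: opt_slope_bound.
exists z; rewrite psi'E; split.
- move=> t; split; last by rewrite rhor; exact: (opt_sol_gt hb r0 gr (zP t)).
  by split=> // w tw; exact: (opt_sol_inj hb (zP t) tw).
- by move=> t; rewrite (psi_eq_sol hb (zP t)) (obj_eq_sol hb (zP t)).
- split.
  + exact: subgradient_convex psid.
  + apply: subgradient_lipschitz psid _ => t.
    by rewrite ler_norml; have /andP[/ltW -> /ltW ->] := dbound t.
  + by move=> t; exact: ex_derive.
  (* [lipschitz] asks for all sufficiently large constants; those at least [K] work. *)
  + rewrite /lipschitz_on; near=> M => -[s t] _ /=.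
    apply: (le_trans (dK _ _ _ _ (zP t) (zP s))).
    by apply: ler_wpM2r => //; near: M; exact: nbhs_pinfty_ge.
- by move=> t; split=> //; exact: (opt_slopeE (zP t)).
- by move=> t; exact: (opt_slope_norm_ge hb (zP t)).
Unshelve. all: by end_near. Qed.
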